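(* Consider the dynamic discrete choice model with unobserved heterogeneity described in the context. Let $\delta_0=[\delta_{u,0},\delta_{F,0}]$ and $\gamma_0=[\gamma_0(1),\dots,\gamma_0(J_1)]\in\mathbb{R}^{\dim(Z)\times J_1}$. Then for each pair $z_1,z_2$ in the support of $Z$ that satisfies $\delta_0^\intercal z_1=\delta_0^\intercal z_2$, $$\Pi_0(z_1)=\Pi_0(z_2)\iff\gamma_0^\intercal z_1=\gamma_0^\intercal z_2 .$$
   Context: Model. In each period $t=1,2,\dots$ (infinite horizon) an agent observes the state $(Z_t,\lambda_t,\epsilon_t)$ and chooses an action $A_t\in\mathcal A=\{0,1,\dots,J_1\}$ to maximize expected discounted utility, with time-separable utility and discount factor $\beta\in[0,1)$. Here $Z_t$ is a random vector in $\mathbb{R}^{\dim(Z)}$ (observed by the econometrician), and $\lambda_t$ and $\epsilon_t=(\epsilon_t(0),\dots,\epsilon_t(J_1))\in\mathbb{R}^{J_1+1}$ are unobserved by the econometrician; $\epsilon_t$ has full support on $\mathbb{R}^{J_1+1}$. The period-$t$ payoff from action $a$ is $$\gamma_0(a)^\intercal Z_t+f(\delta_{u,0}^\intercal Z_t,a,\lambda_t)+\epsilon_t(a),$$ where $\gamma_0(a)\in\mathbb{R}^{\dim(Z)}$, $\delta_{u,0}\in\mathbb{R}^{\dim(Z)\times J_{2,u}}$, and $f$ is a (possibly nonlinear) function. The outside-good normalization $\gamma_0(0)=0$ and $f(\delta_{u,0}^\intercal Z_t,0,\lambda_t)=0$ is imposed. The process $\{Z_t,\epsilon_t,\lambda_t,A_t\}$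 is a stationary first-order Markov process with $$d\Pr(\epsilon_{t+1},z_{t+1},\lambda_{t+1}\mid\epsilon_t,z_t,\lambda_t,a_t)=dF_\epsilon(\epsilon_{t+1})\times dG(z_{t+1},\delta_{F,0}^\intercal z_t,a_t)\times dF_\lambda(\lambda_{t+1}\mid\lambda_t)$$ for some matrix $\delta_{F,0}$ with $\dim(Z)$ rows and some function $G$, so that the transition law of $Z$ is $F_Z(z'\mid z,a)=G(z',\delta_{F,0}^\intercal z,a)$. The choice-specific value function is $$v(a,Z_t,\lambda_t)=\gamma_0(a)^\intercal Z_t+f(\delta_{u,0}^\intercal Z_t,a,\lambda_t)+\beta E[v(Z_{t+1},\lambda_{t+1})\mid Z_t,\lambda_t,A_t=a],$$ where $v(z,\lambda)$ is the equilibrium ex-ante value function, i.e. the expected discounted sum of current and future payoffs from optimal behavior given $(Z_t,\lambda_t)=(z,\lambda)$ before $\epsilon_t$ is observed and $A_t$ chosen; it is assumed to be well defined. The reduced form is $\Pi_0(z)=\{\Pi_0(a,z):a=0,1,\dots,J_1\}$ with $$\Pi_0(a,z)=\int\Pr\left(a=\arg\max_{\tilde a\in\mathcal A}\{v(\tilde a,Z_t,\lambda_t)+\epsilon_t(\tilde a)\}\,\Big|\,Z_t=z,\lambda_t=l\right)dF_{\lambda_t}(l),$$ where $F_{\lambda_t}$ is the marginal distribution of $\lambda_t$. *)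

(* Defs.v *)
From HB Require Import structures.
From mathcomp Require Import all_boot all_order all_algebra.
From mathcomp Require Import all_classical all_reals all_analysis.
From mathcomp Require Import measurable_realfun.

Set Implicit Arguments.
Unset Strict Implicit.
Unset Printing Implicit Defensive.

Import Order.TTheory GRing.Theory Num.Theory.
Import numFieldTopology.Exports numFieldNormedType.Exports.

Local Open Scope classical_set_scope.
Local Open Scope ring_scope.

Definition borel_mx_display : measure_display.
Proof. exact: default_measure_display. Qed.

Section borel_mx.
Variables (R : realType) (m n : nat).
Let borel : set (set 'M[R]_(m, n)) := <<s [set U | open U] >>.

Let borel0 : borel set0. Proof. exact: sigma_algebra0. Qed.
Let borelC (A : set 'M[R]_(m, n)) : borel A -> borel (~` A).
Proof. exact: sigma_algebraC. Qed.
Let borel_bigcup (F : (set 'M[R]_(m, n))^nat) :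
  (forall i, borel (F i)) -> borel (\bigcup_i F i).
Proof. exact: sigma_algebra_bigcup. Qed.

HB.instance Definition _ := @isMeasurable.Build borel_mx_display
  'M[R]_(m, n) borel borel0 borelC borel_bigcup.
End borel_mx.

HB.instance Definition _ (n : nat) := isPointed.Build 'I_n.+1 ord0.
HB.instance Definition _ (n : nat) := @isMeasurable.Build
  default_measure_display 'I_n.+1 discrete_measurable
  discrete_measurable0 discrete_measurableC discrete_measurableU.

Definition msupport (R : realType) (m n : nat)
    (mu : set 'M[R]_(m, n) -> \bar R) : set 'M[R]_(m, n) :=
  [set x | forall U : set 'M[R]_(m, n), open U -> U x -> (0 < mu U)%E].

Definition unique_argmax (R : realType) (I : eqType) (x : I -> R) (a : I) :=
  forall b, b != a -> x b < x a.

(* [k] is the dimension of Z, actions are 0, ..., J, and Ju and JF are the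
   numbers of columns of the two index matrices. *)
Record ddc_model (R : realType) (k J Ju JF : nat)
    (dL : measure_display) (L : measurableType dL) := DdcModel {
  discount : R;
  gamma : 'I_J.+1 -> 'cV[R]_k;
  delta_u : 'M[R]_(k, Ju);
  delta_F : 'M[R]_(k, JF);
  util : 'cV[R]_Ju -> 'I_J.+1 -> L -> R;
  F_Z : 'I_J.+1 -> 'cV[R]_k -> probability 'cV[R]_k R;
  F_lambda : L -> probability L R;
  F_eps : probability 'cV[R]_J.+1 R }.

Section model.
Context {R : realType} {k J Ju JF : nat} {dL : measure_display}
  {L : measurableType dL}.
Variable M : ddc_model R k J Ju JF L.

Local Notation action := 'I_J.+1.
Local Notation Zsp := 'cV[R]_k.
Local Notation Esp := 'cV[R]_J.+1.
Local Notation state := (Zsp * L * Esp)%type.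

Definition gamma0 : 'M[R]_(k, J) :=
  \matrix_(i < k, j < J) gamma M (lift ord0 j) i 0.

Definition delta0 : 'M[R]_(k, Ju + JF) := row_mx (delta_u M) (delta_F M).

Definition det_payoff (a : action) (z : Zsp) (l : L) : R :=
  ((gamma M a)^T *m z) 0 0 + util M ((delta_u M)^T *m z) a l.

Definition payoff (a : action) (s : state) : R :=
  det_payoff a s.1.1 s.1.2 + s.2 a 0.

Definition transition_ZL (a : action) (z : Zsp) (l : L)
  : {measure set (Zsp * L) -> \bar R} := (F_Z M a z \x F_lambda M l)%E.

Definition transition (a : action) (s : state)
  : {measure set state -> \bar R} :=
  (transition_ZL a s.1.1 s.1.2 \x F_eps M)%E.

Record ddc_hypotheses : Prop := DdcHypotheses {
  discount_ge0 : 0 <= discount M;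
  discount_lt1 : discount M < 1;
  gamma_outside : gamma M ord0 = 0;
  util_outside : forall z l, util M ((delta_u M)^T *m z) ord0 l = 0;
  measurable_util : forall a,
    measurable_fun [set: 'cV[R]_Ju * L] (fun x => util M x.1 a x.2);
  kernel_F_Z : forall a (B : set Zsp), measurable B ->
    measurable_fun [set: Zsp] (fun z => F_Z M a z B);
  kernel_F_lambda : forall B : set L, measurable B ->
    measurable_fun [set: L] (fun l => F_lambda M l B);
  index_F_Z : exists G : set Zsp -> 'cV[R]_JF -> action -> \bar R,
    forall a z (B : set Zsp), measurable B ->
      F_Z M a z B = G B ((delta_F M)^T *m z) a;
  full_support_eps : msupport (F_eps M) = [set: Esp] }.

(* Behaviour may depend on the whole history: in state [s], after the states
   [h] (oldest first), the policy [sigma] prescribes [sigma h s]. *)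
Definition policy := seq state -> state -> action.

Definition measurable_policy (sigma : policy) := forall n,
  measurable_fun [set: n.-tuple state * state]
    (fun hs => sigma (tval hs.1) hs.2).

Definition stationary_policy (d : state -> action) : policy := fun _ => d.

(* Expectation of the payoff [u] received [t] periods ahead by an agent who
   is now in state [s] and follows [sigma] from now on. *)
Fixpoint expected_payoff (u : action -> state -> \bar R) (t : nat)
    (sigma : policy) (s : state) : \bar R :=
  if t is t'.+1 then
    (\int[transition (sigma [::] s) s]_s'
       expected_payoff u t' (fun h => sigma (s :: h)) s')%E
  else u (sigma [::] s) s.

Definition discounted_sum (u : action -> state -> \bar R)
    (sigma : policy) (s : state) : \bar R :=
  (\sum_(0 <= t <oo) (discount M ^+ t)%:E * expected_payoff u t sigma s)%E.

Definition lifetime_utility : policy -> state -> \bar R :=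
  discounted_sum (fun a s => (payoff a s)%:E).

Definition summable_payoffs (sigma : policy) (s : state) :=
  (discounted_sum (fun a s' => `|payoff a s'|%:E) sigma s < +oo)%E.

Record optimal (d : state -> action) : Prop := Optimal {
  optimal_measurable : measurable_fun [set: state] d;
  optimal_summable : forall s, summable_payoffs (stationary_policy d) s;
  optimal_max : forall sigma s,
    measurable_policy sigma -> summable_payoffs sigma s ->
    (lifetime_utility sigma s <= lifetime_utility (stationary_policy d) s)%E }.

Section value.
(* the decision rule followed by the agent *)
Variable d : state -> action.

Definition ex_ante_value (z : Zsp) (l : L) : R :=
  fine (\int[F_eps M]_e lifetime_utility (stationary_policy d) (z, l, e))%E.

Record well_defined_value : Prop := WellDefinedValue {
  integrable_lifetime_utility : forall z l,
    (F_eps M).-integrable [set: Esp]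
      (fun e => lifetime_utility (stationary_policy d) (z, l, e));
  integrable_ex_ante_value : forall a z l,
    (transition_ZL a z l).-integrable [set: Zsp * L]
      (fun x => (ex_ante_value x.1 x.2)%:E) }.

Definition choice_value (a : action) (z : Zsp) (l : L) : R :=
  det_payoff a z l +
  discount M * \int[transition_ZL a z l]_x ex_ante_value x.1 x.2.

(* The current shocks have law [F_eps] given (Z, lambda), so the conditional
   choice probability at (z, l) is computed under [F_eps]; [mu] is the
   marginal law of lambda. *)
Definition reduced_form (mu : probability L R) (z : Zsp)
  : {ffun action -> \bar R} :=
  [ffun a => (\int[mu]_l
    F_eps M [set e | unique_argmax (fun b => (choice_value b z l + e b ord0)%R) a])%E].

End value.

Section process.
Context {dO : measure_display} {Omega : measurableType dO}
  {P : probability Omega R}.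
Variables (Z : nat -> {RV P >-> Zsp}) (lambda : nat -> {RV P >-> L})
  (eps : nat -> {RV P >-> Esp}) (A : nat -> {RV P >-> action}).

Definition state_at (t : nat) (w : Omega) : state :=
  (Z t w, lambda t w, eps t w).

Definition observation (t : nat) (w : Omega) : state * action :=
  (state_at t w, A t w).

Definition past (t : nat) : set (set Omega) :=
  <<s [set H | exists i (B : set (state * action)),
        [/\ (i <= t)%N, measurable B & H = observation i @^-1` B]] >>.

(* Index [t] stands for period t+1. Since the action is a function of the
   current state and the law of the next state given the whole past only
   depends on the current observation, the observations form a first-order
   Markov process. *)
Record ddc_process (d : state -> action) : Prop := DdcProcess {
  process_action : forall t, {ae P, forall w, A t w = d (state_at t w)};
  process_transition : forall t H (B : set state),
    past t H -> measurable B ->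
    P (H `&` state_at t.+1 @^-1` B) =
      (\int[P]_(w in H) transition (A t w) (state_at t w) B)%E;
  process_stationary : forall n t (B : nat -> set (state * action)),
    (forall i, measurable (B i)) ->
    P (\bigcap_(i < n) (observation i @^-1` B i)) =
    P (\bigcap_(i < n) (observation (i + t) @^-1` B i)) }.

End process.
End model.

(* Main.v *)
(** Equal indices [delta0^T z] give equal heterogeneity terms and equal
    transition laws of Z, so the choice values at [z1] and [z2] differ by
    [c b = gamma(b)^T (z1 - z2)], with [c 0 = 0]. If [c] is not identically
    zero, then it is not constant; moving from [z2] to [z1] favours an action
    [a] maximizing [c] over every other action, and strictly over some [b].
    The event that [a] is chosen therefore grows by a set containing a nonempty
    open set, which has positive probability under full support, for every
    value of lambda; hence the reduced forms differ at [a]. *)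

Require Import Defs.
From HB Require Import structures.
From mathcomp Require Import all_boot all_order all_algebra.
From mathcomp Require Import all_classical all_reals all_analysis.
From mathcomp Require Import measurable_realfun.
From mathcomp Require Import lra.

Set Implicit Arguments.
Unset Strict Implicit.
Unset Printing Implicit Defensive.

Import Order.TTheory GRing.Theory Num.Theory.
Import numFieldTopology.Exports numFieldNormedType.Exports.

Local Open Scope classical_set_scope.
Local Open Scope ring_scope.

(** * Strict monotonicity of the integral *)

Lemma integral_gt0 d (T : measurableType d) (R : realType)
    (mu : {measure set T -> \bar R}) (f : T -> \bar R) :
  measurable_fun [set: T] f -> (forall x, 0 < f x)%E -> (0 < mu [set: T])%E ->
  (0 < \int[mu]_x f x)%E.
Proof.
move=> mf f_gt0 mu_gt0; have f_ge0 x : (0 <= f x)%E by exact: ltW.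
rewrite lt_neqAle integral_ge0// andbT; apply/eqP => /esym f0.
have : (\int[mu]_x `|f x|)%E = 0%E.
  by rewrite -[RHS]f0; apply: eq_integral => x _; rewrite gee0_abs.
move=> /(ae_eq_integral_abs mu measurableT mf)[N [mN N0 subN]].
suff NT : N = [set: T] by move: mu_gt0; rewrite -NT N0 ltxx.
apply/seteqP; split=> // x _; apply: subN => /(_ I) fx0.
by move: (f_gt0 x); rewrite fx0 ltxx.
Qed.

(** Write [g] as [f + (g - f)]: the strict bound makes [f] finite pointwise, so the subtraction is
    sound, and the finite integral of [f] keeps the gain from [g - f] strict. *)
Lemma ge0_lt_integral d (T : measurableType d) (R : realType)
    (mu : {measure set T -> \bar R}) (f g : T -> \bar R) :
  measurable_fun [set: T] f -> measurable_fun [set: T] g ->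
  (forall x, 0 <= f x)%E -> (forall x, f x < g x)%E ->
  (\int[mu]_x f x < +oo)%E -> (0 < mu [set: T])%E ->
  (\int[mu]_x f x < \int[mu]_x g x)%E.
Proof.
move=> mf mg f_ge0 fg f_fin mu_gt0.
have f_num x : f x \is a fin_num.
  by rewrite ge0_fin_numE//; exact: lt_le_trans (fg x) (leey _).
have mgf : measurable_fun [set: T] (fun x => g x - f x)%E.
  exact: emeasurable_funB.
rewrite [ltRHS](_ : _ = \int[mu]_x (f x + (g x - f x)))%E; last first.
  by apply: eq_integral => x _; rewrite addeC subeK.
rewrite ge0_integralD//; last by move=> x _; rewrite sube_ge0 ?f_num// ltW.
rewrite lteDl; first by apply: integral_gt0 => // x; rewrite sube_gt0.
by rewrite ge0_fin_numE// integral_ge0.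
Qed.

(** * Choice events and their probabilities *)

Lemma measurable_coord (R : realType) m n (i : 'I_m) (j : 'I_n) :
  measurable_fun [set: 'M[R]_(m, n)] (fun A : 'M[R]_(m, n) => A i j).
Proof.
apply: (measurability _ (RGenOpens.measurableE R)) => _ [_ [a [b ->] <-]].
rewrite setTI; apply: sub_sigma_algebra => /=.
by apply: open_comp (interval_open _ _) => // A _; exact: coord_continuous.
Qed.

(** The event inside [reduced_form], with the choice values abstracted to [x]. *)
Definition choice_set (R : realType) (J : nat) (x : 'I_J.+1 -> R) (a : 'I_J.+1)
  : set 'cV[R]_J.+1 := [set e | unique_argmax (fun b => x b + e b ord0) a].

Lemma choice_set_gap (R : realType) (J : nat) (x c : 'I_J.+1 -> R)
    (a b : 'I_J.+1) :
  (forall i, c i <= c a) -> c b < c a ->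
  exists U : set 'cV[R]_J.+1, [/\ open U, U !=set0 &
    U `<=` choice_set (fun i => x i + c i) a `\` choice_set x a].
Proof.
move=> c_le c_lt; pose D := c a - c b.
have D_gt0 : 0 < D by rewrite subr_gt0.
have ba : b != a by apply: contraTneq c_lt => ->; rewrite ltxx.
(* At [e0], under the values [x], the action [b] beats [a] by [D / 2], less
   than the advantage [D] gained by [a] from [c], and the others lag behind. *)
pose e0 : 'cV[R]_J.+1 :=
  \col_i (- x i + (if i == b then D / 2 else if i == a then 0 else - D)).
have D4 : 0 < D / 4 by rewrite divr_gt0.
(* On this ball a difference of two shocks moves by less than [D / 2], which is the margin at [e0]
   both of [b] over [a] under [x] and of [a] over [b] under [x + c]. *)
exists (ball e0 (D / 4)); split.
- exact: ball_open.
- by exists e0; exact: ballxx.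
move=> e e_near.
have {}e_near i : `|e0 i ord0 - e i ord0| < D / 4.
  by have [_ /(_ i ord0)] := e_near.
have near_b := e_near b; have near_a := e_near a.
rewrite mxE eqxx ltr_norml in near_b.
rewrite mxE eqxx eq_sym (negbTE ba) ltr_norml in near_a.
split.
  move=> i ia; have := e_near i; rewrite mxE (negbTE ia) ltr_norml.
  have := c_le i.
  by case: (eqVneq i b) => [->|_]; move: near_a near_b;
    rewrite /D => /andP[? ?] /andP[? ?] ? /andP[? ?]; lra.
move=> /(_ b ba); move: near_a near_b.
by rewrite /D => /andP[? ?] /andP[? ?]; lra.
Qed.

Lemma choice_set_subset (R : realType) (J : nat) (x c : 'I_J.+1 -> R)
    (a : 'I_J.+1) :
  (forall i, c i <= c a) ->
  choice_set x a `<=` choice_set (fun i => x i + c i) a.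
Proof. by move=> c_le e e_x i ia; have := e_x i ia; have := c_le i; lra. Qed.

Section random_choice.
Context d (T : measurableType d) (R : realType) (J : nat).
Implicit Types (x : T -> 'I_J.+1 -> R) (F : probability 'cV[R]_J.+1 R).

(** Joint measurability in parameter and shocks is what makes the probability of a section
    measurable in the parameter. The graph is a finite intersection of strict comparisons. *)
Lemma measurable_choice_graph x a :
  (forall b, measurable_fun [set: T] (x ^~ b)) ->
  measurable [set p : T * 'cV[R]_J.+1 | choice_set (x p.1) a p.2].
Proof.
move=> mx.
have mxe b : measurable_fun [set: T * 'cV[R]_J.+1]
    (fun p => x p.1 b + p.2 b ord0).
  apply: measurable_funD; first exact: measurableT_comp (mx b) measurable_fst.
  exact: measurableT_comp (measurable_coord b ord0) measurable_snd.
rewrite [X in measurable X](_ : _ = \bigcap_(b in [set b | b != a])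
    [set p : T * 'cV[R]_J.+1 | x p.1 b + p.2 b ord0 < x p.1 a + p.2 a ord0]).
  apply: fin_bigcap_measurable => [|b _]; first exact: finite_finset.
  have := measurable_fun_ltr (mxe b) (mxe a) measurableT
    (_ : measurable [set true]).
  by rewrite setTI; exact.
by apply/seteqP; split.
Qed.

Lemma xsection_choice_graph x a t :
  xsection [set p : T * 'cV[R]_J.+1 | choice_set (x p.1) a p.2] t =
  choice_set (x t) a.
Proof. by apply/seteqP; split=> e; rewrite /xsection /= inE. Qed.

Lemma measurable_choice_prob F x a :
  (forall b, measurable_fun [set: T] (x ^~ b)) ->
  measurable_fun [set: T] (fun t => F (choice_set (x t) a)).
Proof.
move=> mx; have /(measurable_fun_xsection F) := measurable_choice_graph a mx.
apply: eq_measurable_fun => t _ /=.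
by rewrite xsection_choice_graph.
Qed.

End random_choice.

Lemma measurable_choice_set (R : realType) (J : nat) (x : 'I_J.+1 -> R)
    (a : 'I_J.+1) :
  measurable (choice_set x a).
Proof.
have mx (b : 'I_J.+1) : measurable_fun [set: R] (fun=> x b) by [].
(* A fixed choice set is a section of the graph of a constant family, here over the arbitrary
   parameter space [R]. *)
rewrite -[X in measurable X](xsection_choice_graph (fun=> x) a (0 : R)).
have /(measurable_xsection (0 : R)) := measurable_choice_graph a mx.
exact.
Qed.

Lemma choice_prob_lt (R : realType) (J : nat) (F : probability 'cV[R]_J.+1 R)
    (x c : 'I_J.+1 -> R) (a b : 'I_J.+1) :
  msupport F = setT -> (forall i, c i <= c a) -> c b < c a ->
  (F (choice_set x a) < F (choice_set (fun i => x i + c i)%R a))%E.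
Proof.
move=> suppF c_le c_lt.
have mE := measurable_choice_set x a.
have mE' := measurable_choice_set (fun i => x i + c i) a.
rewrite -(setDUK (choice_set_subset c_le)).
have mD := measurableD mE' mE.
rewrite measureU//; last by rewrite setDE setICA setICr setI0.
rewrite lteDl ?fin_num_measure//.
have [U [oU [e Ue] subU]] := choice_set_gap x c_le c_lt.
have : msupport F e by rewrite suppF.
move=> /(_ U oU Ue) /lt_le_trans; apply; apply: le_measure => //; rewrite inE//.
exact: sub_sigma_algebra.
Qed.

(** The gain at every [t] survives averaging because choice probabilities are at most 1 and [mu] has
    mass 1. *)
Lemma integral_choice_prob_lt d (T : measurableType d) (R : realType) (J : nat)
    (mu : probability T R) (F : probability 'cV[R]_J.+1 R)
    (x : T -> 'I_J.+1 -> R) (c : 'I_J.+1 -> R) (a b : 'I_J.+1) :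
  (forall i, measurable_fun [set: T] (x ^~ i)) ->
  msupport F = setT -> (forall i, c i <= c a) -> c b < c a ->
  (\int[mu]_t F (choice_set (x t) a) <
   \int[mu]_t F (choice_set (fun i => x t i + c i)%R a))%E.
Proof.
move=> mx suppF c_le c_lt.
have mF := measurable_choice_prob F a mx.
pose y t i := x t i + c i.
have my i : measurable_fun [set: T] (y ^~ i) by exact: measurable_funD.
have mG := measurable_choice_prob F a my.
have mu1 : mu [set: T] = 1%E by exact: probability_setT.
apply: ge0_lt_integral => //.
- by move=> t; exact: choice_prob_lt c_le c_lt.
- apply: (@le_lt_trans _ _ (\int[mu]_t cst 1%E t)%E).
    apply: ge0_le_integral => // t _.
    by apply: probability_le1; exact: measurable_choice_set.
  by rewrite integral_cst// mul1e [X in (X < _)%E]mu1 ltry.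
- by have := @lte01 R; rewrite -mu1.
Qed.

(** Meant for continuation values as functions of lambda, with the law of the next Z fixed. Tonelli
    integrates over [m1] first and leaves a kernel integral against [m2 t]; signs are handled by
    positive and negative parts. *)
Lemma measurable_prod_integral d1 d2 d3 (T1 : measurableType d1)
    (T2 : measurableType d2) (X : measurableType d3) (R : realType)
    (m1 : {sigma_finite_measure set T1 -> \bar R})
    (m2 : X -> {sigma_finite_measure set T2 -> \bar R})
    (f : T1 * T2 -> \bar R) :
  (forall B, measurable B -> measurable_fun [set: X] (fun t => m2 t B)) ->
  measurable_fun [set: T1 * T2] f ->
  measurable_fun [set: X] (fun t => \int[m1 \x m2 t]_p f p)%E.
Proof.
move=> mm2 mf.
have ge0_case (g : T1 * T2 -> \bar R) : (forall p, 0 <= g p)%E ->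
    measurable_fun [set: T1 * T2] g ->
    measurable_fun [set: X] (fun t => \int[m1 \x m2 t]_p g p)%E.
  move=> g0 mg.
  under eq_fun do rewrite fubini_tonelli2//.
  apply: measurable_fun_integral_kernel => //.
    by move=> y; apply: integral_ge0.
  exact: measurable_fun_fubini_tonelli_G.
under eq_fun do rewrite integralE.
by apply: emeasurable_funB; apply: ge0_case => //;
  [exact: measurable_funepos|exact: measurable_funeneg].
Qed.

Section model.
Context {R : realType} {k J Ju JF : nat} {dL : measure_display}
  {L : measurableType dL} (M : ddc_model R k J Ju JF L).
Implicit Type d : 'cV[R]_k * L * 'cV[R]_J.+1 -> 'I_J.+1.

Lemma measurable_choice_value d a z :
  ddc_hypotheses M -> well_defined_value M d ->
  measurable_fun [set: L] (choice_value M d a z).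
Proof.
move=> hM vM; apply: measurable_funD.
  apply: measurable_funD => //.
  exact: measurableT_comp (measurable_util hM a) (pair1_measurable _).
apply: measurable_funM => //.
apply: measurableT_comp => //.
apply: measurable_prod_integral; first exact: kernel_F_lambda.
(* the joint measurability of the ex-ante value is part of its integrability *)
by have /measurable_int := integrable_ex_ante_value vM a z point.
Qed.

Lemma choice_value_shift d a z1 z2 l :
  ddc_hypotheses M -> (delta0 M)^T *m z1 = (delta0 M)^T *m z2 ->
  choice_value M d a z1 l =
  choice_value M d a z2 l + ((gamma M a)^T *m (z1 - z2)) ord0 ord0.
Proof.
move=> hM; rewrite /delta0 tr_row_mx !mul_col_mx => /eq_col_mx[eq_u eq_F].
have [G FG] := index_F_Z hM.
have eq_F_Z B : measurable B -> F_Z M a z1 B = F_Z M a z2 B.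
  by move=> mB; rewrite !FG// eq_F.
have eq_cont : \int[transition_ZL M a z1 l]_x ex_ante_value M d x.1 x.2 =
    \int[transition_ZL M a z2 l]_x ex_ante_value M d x.1 x.2.
  (* A product measure is the integral of section measures against its first factor, so equality of
     the laws of Z on measurable sets passes to the product. *)
  congr fine; apply: eq_measure_integral => B mB _.
  by apply: eq_measure_integral => C mC _; exact: eq_F_Z.
rewrite /choice_value /det_payoff eq_cont eq_u mulmxBr !mxE.
by lra.
Qed.

Lemma reduced_formE d mu z a : reduced_form M d mu z a =
  (\int[mu]_l F_eps M (choice_set (fun b => choice_value M d b z l) a))%E.
Proof. exact: ffunE. Qed.

End model.

Theorem theorem1 (R : realType) (k J Ju JF : nat)
    (dL : measure_display) (L : measurableType dL)
    (M : ddc_model R k J Ju JF L) (hM : ddc_hypotheses M)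
    (d : 'cV[R]_k * L * 'cV[R]_J.+1 -> 'I_J.+1)
    (d_optimal : optimal M d) (v_well_defined : well_defined_value M d)
    (dO : measure_display) (Omega : measurableType dO)
    (P : probability Omega R)
    (Z : nat -> {RV P >-> 'cV[R]_k}) (lambda : nat -> {RV P >-> L})
    (eps : nat -> {RV P >-> 'cV[R]_J.+1}) (A : nat -> {RV P >-> 'I_J.+1})
    (process : ddc_process M Z lambda eps A d)
    (t : nat) (z1 z2 : 'cV[R]_k)
    (z1_support : msupport (distribution P (Z t)) z1)
    (z2_support : msupport (distribution P (Z t)) z2)
    (same_index : (delta0 M)^T *m z1 = (delta0 M)^T *m z2) :
  reduced_form M d (distribution P (lambda t)) z1 =
    reduced_form M d (distribution P (lambda t)) z2 <->
  (gamma0 M)^T *m z1 = (gamma0 M)^T *m z2.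
Proof.
pose c b : R := ((gamma M b)^T *m (z1 - z2)) ord0 ord0.
have shift l : (fun b => choice_value M d b z1 l) =
    (fun b => choice_value M d b z2 l + c b).
  by apply/funext => b; exact: choice_value_shift.
(* Column [j] of [gamma0] belongs to action [j + 1]; the outside action is treated separately by its
   normalization. *)
have c_lift (j : 'I_J) : c (lift ord0 j) = ((gamma0 M)^T *m (z1 - z2)) j ord0.
  by rewrite /c !mxE; apply: eq_bigr => i _; rewrite !mxE.
have c0 : c ord0 = 0 by rewrite /c (gamma_outside hM) trmx0 mul0mx mxE.
have mv b : measurable_fun [set: L] (fun l => choice_value M d b z2 l).
  exact: measurable_choice_value.
split=> [eq_rf|eq_gamma]; last first.
  have cE b : c b = 0.
    case: (unliftP ord0 b) => [j|] ->//.
    by rewrite c_lift mulmxBr eq_gamma subrr mxE.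
  apply: eq_ffun => a; apply: eq_integral => l _.
  congr (F_eps M (choice_set _ a)); rewrite shift.
  by apply/funext => b; rewrite cE addr0.
pose a := [arg max_(a > ord0) c a]%O.
have c_le b : c b <= c a.
  by rewrite /a; case: (@arg_maxP _ _ _ ord0 xpredT c isT) => i _; apply.
apply: subr0_eq; rewrite -mulmxBr; apply/matrixP => j j0.
rewrite ord1 -c_lift mxE.
(* Any [b] below the maximum would make the two reduced forms differ at [a]. A constant [c] is then
   zero, by its value at the outside action. *)
have c_const b : c b = c a.
  apply/eqP; rewrite eq_le c_le/= leNgt; apply/negP => c_lt.
  have := integral_choice_prob_lt (distribution P (lambda t)) mv
    (full_support_eps hM) c_le c_lt.
  under [X in (_ < X)%E -> _]eq_integral do rewrite -shift.
  rewrite -[X in (_ < X)%E](reduced_formE M d _ z1 a) eq_rf.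
  by rewrite [X in (_ < X)%E](reduced_formE M d _ z2 a) ltxx.
by rewrite c_const -c0 c_const.
Qed.
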